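(* Let $A$ be a commutative ring, let $\Sigma$ be a finite complete fan in $N_{\mathbb{R}}$ of strongly convex rational polyhedral cones with associated toric $A$-scheme $X_\Sigma$, let $h \colon N_{\mathbb{R}} \to \mathbb{R}$ be a support function on $\Sigma$, and let $L_h$ be the associated algebraic line bundle on $X_\Sigma$. For $\mathbf{b} \in M$ let $$S(h,\mathbf{b}) = \bigcup_{\sigma \in \Sigma,\ \mathbf{b}+h_\sigma \in \sigma^\vee} \bar\sigma \ \subseteq S^{n-1}.$$ Then for all $\mathbf{b} \in M$ and all $k$ there is an isomorphism of $A$-modules $$H^k(X_\Sigma; L_h)_{\mathbf{b}} \cong \tilde H_{n-1-k}(S(h,\mathbf{b}); A),$$ where $\tilde H_d(\,\cdot\,;A)$ denotes reduced cellular (or singular) homology with coefficients in $A$.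
   Context: $M \cong \mathbb{Z}^n$ is a lattice of rank $n$, $N = \mathrm{Hom}_{\mathbb{Z}}(M,\mathbb{Z})$, $M_{\mathbb{R}} = M \otimes \mathbb{R}$, $N_{\mathbb{R}} = N \otimes \mathbb{R}$, with evaluation pairing $\langle\cdot,\cdot\rangle$ and the identification $\mathrm{Hom}_{\mathbb{Z}}(N,\mathbb{Z}) = M$. For a cone $\sigma \subset N_{\mathbb{R}}$, $\sigma^\vee = \{x \in M_{\mathbb{R}} : \langle x,y\rangle \ge 0\ \forall y \in \sigma\}$. $X_\Sigma$ is glued from the affine $A$-schemes $U_\sigma = \mathrm{Spec}\,A[M \cap \sigma^\vee]$, $\sigma \in \Sigma$. Support function: $h \colon N_{\mathbb{R}} \to \mathbb{R}$ such that for every $\sigma \in \Sigma$ there is $h_\sigma \in \mathrm{Hom}_{\mathbb{Z}}(N,\mathbb{Z}) = M$ with $h|_\sigma = (h_\sigma \otimes \mathrm{id}_{\mathbb{R}})|_\sigma$; $h_\sigma$ is well defined up to adding a linear function vanishing on $N \cap \sigma$. Line bundle: the sections of $L_h$ over $U_\sigma$ are the free $A[M\cap\sigma^\vee]$-submodule of rank $1$ of $A[M]$ with basis the element $-h_\sigma \in M$; restriction maps are inclusions in $A[M]$. All these modules are $M$-graded. Cells: $S^{n-1} \subset N_{\mathbb{R}}$ is the unit sphere for some inner product, with the regular CW structure with cells $\bar\sigma = \sigma \cap S^{n-1}$, $\sigma \in \Sigma$ (including the empty cell $\bar 0$). Fix orientations of cells; $[\bar\sigma:\bar\tau]\in\{-1,0,1\}$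 are the incidence numbers, with $[\bar\tau:\bar 0]=1$ for $1$-dimensional $\tau$. The set $S(h,\mathbf{b})$ is a subcomplex of $S^{n-1}$. Grading on cohomology: $H^k(X_\Sigma;L_h)$ is the $k$-th cohomology of the cochain complex $\mathcal{C}^d = \bigoplus_{\mathrm{codim}\,\sigma = d} \Gamma(U_\sigma; L_h)$ with differential given on summands by $[\bar\sigma:\bar\tau]$ times the restriction map. This complex is $M$-graded with differentials homogeneous of degree $0$, and $H^k(X_\Sigma;L_h)_{\mathbf{b}}$ denotes the resulting degree-$\mathbf{b}$ summand of $H^k(X_\Sigma;L_h) = \bigoplus_{\mathbf{b}\in M} H^k(X_\Sigma;L_h)_{\mathbf{b}}$. Convention: reduced homology is computed from the augmented chain complex with augmentation in degree $-1$, so $\tilde H_{-1}(\emptyset;A) = A$ and $\tilde H_{-1}(Y;A) = 0$ for $Y \neq \emptyset$. *)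

(* Defs.v *)
From HB Require Import structures.
From mathcomp Require Import all_boot all_order all_algebra.
From mathcomp Require Import finmap generic_quotient.
From mathcomp Require Import boolp classical_sets functions cardinality fsbigop.
From mathcomp Require Import reals.

Set Implicit Arguments.
Unset Strict Implicit.
Unset Printing Implicit Defensive.

Import Order.TTheory GRing.Theory Num.Theory.
Local Open Scope classical_set_scope.
Local Open Scope ring_scope.

Record submod (A : pzRingType) (V : lmodType A) := Submod {
  submod_set :> V -> Prop;
  submod0 : submod_set 0;
  submodZD : forall a x y,
    submod_set x -> submod_set y -> submod_set (a *: x + y) }.

Section Submodules.
Variables (A : pzRingType) (V : lmodType A).

Definition submod_pred (S : submod V) : {pred V} := fun x => `[< S x >].

Lemma submod_predP (S : submod V) x : reflect (S x) (x \in submod_pred S).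
Proof. exact: asboolP. Qed.

Fact submod_pred_closed (S : submod V) : submod_closed (submod_pred S).
Proof.
split; first exact/submod_predP/submod0.
by move=> a x y /submod_predP Sx /submod_predP Sy; apply/submod_predP/submodZD.
Qed.
HB.instance Definition _ (S : submod V) :=
  GRing.isSubmodClosed.Build A V (submod_pred S) (submod_pred_closed S).

Record submod_type (S : submod V) := SubmodType {
  submod_val : V;
  submod_valP : submod_val \in submod_pred S }.
HB.instance Definition _ (S : submod V) :=
  [isSub for @submod_val S].
HB.instance Definition _ (S : submod V) := [Choice of submod_type S by <:].
HB.instance Definition _ (S : submod V) :=
  [SubChoice_isSubLmodule of submod_type S by <:].

Definition quotmod (S : submod V) : Type := Quotient.quot (submod_pred S).
HB.instance Definition _ (S : submod V) := GRing.Zmodule.on (quotmod S).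

Section Quotient.
Variable S : submod V.
Local Notation Q := (Quotient.quot (submod_pred S)).

Definition quot_class (x : V) : quotmod S := (\pi_Q x)%qT.

Lemma quot_class_surj (q : quotmod S) : exists x, q = quot_class x.
Proof. by exists (repr (q : Q)); rewrite /quot_class reprK. Qed.

Lemma quot_class_eq x y : quot_class x = quot_class y <-> S (x - y).
Proof.
split=> [/eqP|/(submod_predP S)].
  by rewrite -(Quotient.idealrBE (submod_pred S)) => /submod_predP.
by rewrite (Quotient.idealrBE (submod_pred S)) => /eqP.
Qed.

Lemma quot_classD x y : quot_class (x + y) = quot_class x + quot_class y.
Proof. by rewrite /quot_class !piE. Qed.

Definition quot_scale (a : A) (q : quotmod S) : quotmod S :=
  quot_class (a *: repr (q : Q)).

Lemma quot_scale_class a x : quot_scale a (quot_class x) = quot_class (a *: x).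
Proof.
apply/quot_class_eq; rewrite -scalerBr -[X in S X]addr0.
apply: submodZD; last exact: submod0.
by apply/quot_class_eq; rewrite /quot_class reprK.
Qed.

Fact quot_scaleA a b q : quot_scale a (quot_scale b q) = quot_scale (a * b) q.
Proof.
by have [x ->] := quot_class_surj q; rewrite !quot_scale_class scalerA.
Qed.

Fact quot_scale1 : left_id 1 quot_scale.
Proof.
by move=> q; have [x ->] := quot_class_surj q; rewrite quot_scale_class scale1r.
Qed.

Fact quot_scaleDr : right_distributive quot_scale +%R.
Proof.
move=> a p q; have [x ->] := quot_class_surj p; have [y ->] := quot_class_surj q.
by rewrite -quot_classD !quot_scale_class scalerDr quot_classD.
Qed.

Fact quot_scaleDl q : {morph quot_scale^~ q : a b / a + b}.
Proof.
move=> a b; have [x ->] := quot_class_surj q.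
by rewrite !quot_scale_class scalerDl quot_classD.
Qed.

HB.instance Definition _ := GRing.Zmodule_isLmodule.Build A (quotmod S)
  quot_scaleA quot_scale1 quot_scaleDr quot_scaleDl.

Lemma quot_classZ a x : quot_class (a *: x) = a *: quot_class x.
Proof. by rewrite -quot_scale_class. Qed.

End Quotient.
End Submodules.

(* The modules of a complex are submodules of one ambient module [V], and the
   differentials are restrictions of one endomorphism [D] of [V]. *)

Section Homology.
Variables (A : pzRingType) (V : lmodType A) (D : {linear V -> V}).

Fact cycles_subproof0 (C : submod V) : C 0 /\ D 0 = 0.
Proof. by split; [exact: submod0 | exact: linear0]. Qed.

Fact cycles_subproofZD (C : submod V) a x y :
  C x /\ D x = 0 -> C y /\ D y = 0 -> C (a *: x + y) /\ D (a *: x + y) = 0.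
Proof.
move=> [Cx Dx0] [Cy Dy0]; split; first exact: submodZD.
by rewrite linearP Dx0 Dy0 scaler0 addr0.
Qed.

Definition cycles (C : submod V) : submod V :=
  Submod (cycles_subproof0 C) (@cycles_subproofZD C).

Variables C' C : submod V.

Fact boundaries_subproof0 :
  exists2 y, C' y & submod_val (0 : submod_type (cycles C)) = D y.
Proof. by exists 0; [exact: submod0 | rewrite linear0]. Qed.

Fact boundaries_subproofZD a (x y : submod_type (cycles C)) :
  (exists2 z, C' z & submod_val x = D z) ->
  (exists2 z, C' z & submod_val y = D z) ->
  exists2 z, C' z & submod_val (a *: x + y) = D z.
Proof.
move=> [z1 Cz1 Ez1] [z2 Cz2 Ez2]; exists (a *: z1 + z2).
  exact: submodZD.
by rewrite linearP -Ez1 -Ez2.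
Qed.

Definition boundaries : submod (submod_type (cycles C)) :=
  Submod boundaries_subproof0 boundaries_subproofZD.

(* The homology at [C] of a complex [... -> C' -> C -> ...]. *)
Definition homology : lmodType A := quotmod boundaries.

End Homology.

(* The lattices [M] and [N] are both ['rV[int]_n], in dual bases, so that
   [M_R] and [N_R] are ['rV[R]_n] and the pairing is the dot product. *)

Section Cones.
Variables (R : realType) (n : nat).

Definition pairing (x y : 'rV[R]_n) : R := \sum_(i < n) x 0 i * y 0 i.

Definition toR (m : 'rV[int]_n) : 'rV[R]_n := map_mx intr m.

Definition dual (s : set 'rV[R]_n) : set 'rV[R]_n :=
  [set x | forall y, s y -> 0 <= pairing x y].

Definition rational_polyhedral (s : set 'rV[R]_n) :=
  exists (k : nat) (g : 'I_k -> 'rV[int]_n),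
    s = [set y | exists c : 'I_k -> R,
           (forall i, 0 <= c i) /\ y = \sum_(i < k) c i *: toR (g i)].

Definition strongly_convex (s : set 'rV[R]_n) :=
  forall y, s y -> s (- y) -> y = 0.

Definition is_face (t s : set 'rV[R]_n) :=
  exists2 u, dual s u & t = s `&` [set y | pairing u y = 0].

(* The largest size of a linearly independent family in [s], which is the
   dimension of the linear span of [s]. *)
Definition cone_dim (s : set 'rV[R]_n) : nat :=
  \max_(d < n.+1 | `[< exists B : 'M[R]_(d, n),
                         row_free B /\ forall i, s (row i B) >]) d.

Definition is_fan (Sigma : {fset set 'rV[R]_n}) :=
  [/\ forall s, s \in Sigma -> rational_polyhedral s /\ strongly_convex s,
      forall s t, s \in Sigma -> is_face t s -> t \in Sigma &
      forall s t, s \in Sigma -> t \in Sigma ->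
        is_face (s `&` t) s /\ is_face (s `&` t) t].

Definition is_complete (Sigma : {fset set 'rV[R]_n}) :=
  forall y, exists2 s, s \in Sigma & s y.

Definition linear_on (s : set 'rV[R]_n) (h : 'rV[R]_n -> R) (m : 'rV[int]_n) :=
  forall y, s y -> h y = pairing (toR m) y.

Definition is_support_function (Sigma : {fset set 'rV[R]_n})
    (h : 'rV[R]_n -> R) :=
  forall s : Sigma, exists m, linear_on (val s) h m.

(* [Q] is the Gram matrix of an inner product on [N_R]. *)
Definition is_inner_product (Q : 'M[R]_n) :=
  Q^T = Q /\ forall y : 'rV[R]_n, y != 0 -> 0 < (y *m Q *m y^T) 0 0.

Definition sphere (Q : 'M[R]_n) : set 'rV[R]_n :=
  [set y | (y *m Q *m y^T) 0 0 = 1].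

Definition cell (Q : 'M[R]_n) (s : set 'rV[R]_n) : set 'rV[R]_n :=
  s `&` sphere Q.

Section Orientations.
Variable Sigma : {fset set 'rV[R]_n}.

(* An orientation of the cell of [s] amounts to an orientation of the linear
   span of [s]: the tangent vectors [w] at a point [x] of the cell form a
   positive basis iff [(x, w)] is a positive basis of the span. The rows of
   [o s] are a positive basis. *)
Variable o : forall s : Sigma, 'M[R]_(cone_dim (val s), n).

(* [[s : t]] compares the orientation of [t] with the boundary orientation of
   [s] (outward normal first). For [v] in [s] but not in [t], [- v] points
   outward along [t], so [w] is a positive basis of the boundary at [x] iff
   [(x, - v, w)], equivalently [(v, x, w)], is a positive basis of the span of
   [s]. Hence the incidence number is the sign of the determinant of
   [(v, rows of o t)] in the basis [o s]. *)
Definition incidence (s t : Sigma) : int :=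
  if `[< is_face (val t) (val s) /\
         cone_dim (val s) = (cone_dim (val t)).+1 >]
  then
    let v := xget 0 (val s `\` val t) in
    sgz (\det (conform_mx (0 : 'M[R]_(cone_dim (val s)))
                 (col_mx v (o t) *m pinvmx (o s))))
  else 0.

(* The last condition states that the incidence numbers of the 0-cells with
   the empty cell are those of the augmentation. *)
Definition is_orientation :=
  [/\ forall s : Sigma, row_free (o s),
      forall (s : Sigma) y, val s y -> (y <= o s)%MS &
      forall t t0 : Sigma, cone_dim (val t) = 1%N -> val t0 = [set 0] ->
        incidence t t0 = 1].

(* The common formula for the coboundary of the complex of sections and for
   the boundary of the cellular chain complex. *)
Definition incidence_map (V : zmodType) (f : {ffun Sigma -> V}) :
    {ffun Sigma -> V} :=
  [ffun t => \sum_(s : Sigma) f s *~ incidence s t].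

Fact incidence_map_is_linear (A : pzRingType) (V : lmodType A) :
  linear (@incidence_map V).
Proof.
move=> a f g; apply/ffunP=> t; rewrite !ffunE scaler_sumr -big_split /=.
by apply: eq_bigr => s _; rewrite !ffunE mulrzDl scalerMzr.
Qed.
HB.instance Definition _ (A : pzRingType) (V : lmodType A) :=
  GRing.isLinear.Build A {ffun Sigma -> V} {ffun Sigma -> V} _
    (@incidence_map V) (@incidence_map_is_linear A V).

(* Chains in degree [d] are the functions on the cells of dimension [d] that
   lie in [S], where the cell of [s] has dimension [dim s - 1]; the empty cell,
   of degree [-1], gives the augmentation. *)

Section Chains.
Variables (A : comPzRingType) (Q : 'M[R]_n) (S : set 'rV[R]_n) (d : int).

Definition chains_set (c : {ffun Sigma -> A^o}) :=
  forall s : Sigma,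
    ~ (cell Q (val s) `<=` S /\ (cone_dim (val s))%:Z - 1 = d) -> c s = 0.

Fact chains_subproof0 : chains_set 0.
Proof. by move=> s _; rewrite ffunE. Qed.

Fact chains_subproofZD a x y :
  chains_set x -> chains_set y -> chains_set (a *: x + y).
Proof. by move=> x0 y0 s ns; rewrite !ffunE x0 // y0 // scaler0 addr0. Qed.

Definition chains : submod {ffun Sigma -> A^o} :=
  Submod chains_subproof0 chains_subproofZD.

End Chains.

Definition reduced_homology (A : comPzRingType) (Q : 'M[R]_n)
    (S : set 'rV[R]_n) (d : int) : lmodType A :=
  homology (@incidence_map A^o) (chains A Q S (d + 1)) (chains A Q S d).

Section LineBundle.
Variables (A : comPzRingType) (hs : Sigma -> 'rV[int]_n).
Local Notation M := 'rV[int]_n.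
(* [A^o] is [A] as a module over itself. *)
Local Notation AM := (M -> A^o).

(* The elements of [A[M]] are the finitely supported functions on [M]. *)
Definition finitely_supported (f : AM) := finite_set [set m | f m != 0].

Definition convolution (f g : AM) : AM :=
  fun m => \sum_(m' \in [set: M]) f m' * g (m - m').

Definition monomial (m : M) : AM := fun m' => (m' == m)%:R.

(* The subring [A[M /\ s^v]] of [A[M]]. *)
Definition affine_algebra (s : set 'rV[R]_n) (f : AM) :=
  finitely_supported f /\ forall m, f m != 0 -> dual s (toR m).

(* The sections of [L_h] over [U_s]. *)
Definition sections (s : Sigma) (f : AM) :=
  exists2 g, affine_algebra (val s) g & f = convolution g (monomial (- hs s)).

Lemma convolution_monomial (f : AM) m :
  convolution f (monomial m) = fun m' => f (m' - m).
Proof.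
apply/funext => m'; rewrite /convolution -(@fsbig_widen _ _ _ _ [set m' - m]) //.
  by rewrite fsbig_set1 /monomial subKr eqxx mulr1.
move=> x /= [_ xm]; rewrite /monomial; case: eqP => [E|_]; last exact: mulr0.
by case: xm; rewrite -E subKr.
Qed.

Lemma affine_algebra0 (s : set 'rV[R]_n) : affine_algebra s 0.
Proof.
split; last by move=> m; rewrite eqxx.
by apply: sub_finite_set (finite_set0 M) => m /=; rewrite eqxx.
Qed.

Lemma affine_algebraZD (s : set 'rV[R]_n) a (f g : AM) :
  affine_algebra s f -> affine_algebra s g -> affine_algebra s (a *: f + g).
Proof.
move=> [ff sf] [fg sg].
have fgD m : (a *: f + g) m != 0 -> (f m != 0) \/ (g m != 0).
  move=> nz; apply/orP; apply: contraNT nz.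
  rewrite negb_or !negbK => /andP[/eqP f0 /eqP g0].
  have -> : (a *: f + g) m = a *: f m + g m by [].
  by rewrite f0 g0 scaler0 addr0.
split; last by move=> m /fgD [/sf | /sg].
apply: (@sub_finite_set _ _ ([set m | f m != 0] `|` [set m | g m != 0])).
  exact: fgD.
by rewrite finite_setU.
Qed.

Fact sections_subproof0 (s : Sigma) : sections s 0.
Proof.
by exists 0; [exact: affine_algebra0 | rewrite convolution_monomial].
Qed.

Fact sections_subproofZD (s : Sigma) a (f g : AM) :
  sections s f -> sections s g -> sections s (a *: f + g).
Proof.
move=> [f' sf ->] [g' sg ->]; exists (a *: f' + g').
  exact: affine_algebraZD.
by rewrite !convolution_monomial.
Qed.

Section Cochains.
Variable k : int.

(* The direct sum of the sections over [U_s] for [s] of codimension [k], inside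
   the functions from [Sigma] to [A[M]]. *)
Definition cochains_set (f : {ffun Sigma -> AM}) :=
  forall s : Sigma, sections s (f s) /\
    (n%:Z - (cone_dim (val s))%:Z <> k -> f s = 0).

Fact cochains_subproof0 : cochains_set 0.
Proof. by move=> s; rewrite ffunE; split=> //; exact: sections_subproof0. Qed.

Fact cochains_subproofZD a f g :
  cochains_set f -> cochains_set g -> cochains_set (a *: f + g).
Proof.
move=> Cf Cg s; have [fs f0] := Cf s; have [gs g0] := Cg s.
rewrite !ffunE; split; first exact: sections_subproofZD.
by move=> sk; rewrite f0 // g0 // scaler0 addr0.
Qed.

Definition cochains : submod {ffun Sigma -> AM} :=
  Submod cochains_subproof0 cochains_subproofZD.

End Cochains.

Variable k : int.

(* The restriction maps are inclusions in [A[M]], so the coboundary is given by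
   the incidence numbers alone. *)
Definition cohomology : lmodType A :=
  homology (@incidence_map AM) (cochains (k - 1)) (cochains k).

(* The grading of the cohomology induced by that of the cochains: the classes
   of the cocycles that are homogeneous of degree [b]. *)
Variable b : M.

Definition homogeneous (f : {ffun Sigma -> AM}) :=
  forall (s : Sigma) (m : M), m != b -> f s m = 0.

Definition cohomology_degree_set (x : cohomology) :=
  exists2 z, homogeneous (submod_val z) & x = quot_class _ z.

Fact cohomology_degree_subproof0 : cohomology_degree_set 0.
Proof.
exists 0; last by rewrite -[LHS](scale0r (quot_class _ 0)) -quot_classZ scale0r.
by move=> s m _; rewrite ffunE.
Qed.

Fact cohomology_degree_subproofZD a x y :
  cohomology_degree_set x -> cohomology_degree_set y ->
  cohomology_degree_set (a *: x + y).
Proof.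
move=> [z hz ->] [w hw ->]; exists (a *: z + w).
  move=> s m mb.
  have -> : submod_val (a *: z + w) s m = a *: submod_val z s m + submod_val w s m.
    by rewrite -[submod_val (a *: z + w)]/(a *: submod_val z + submod_val w) !ffunE.
  by rewrite hz // hw // scaler0 addr0.
by rewrite quot_classD quot_classZ.
Qed.

Definition cohomology_degree : lmodType A :=
  submod_type (Submod cohomology_degree_subproof0 cohomology_degree_subproofZD).

(* [S(h, b)] *)
Definition support_subcomplex (Q : 'M[R]_n) : set 'rV[R]_n :=
  \bigcup_(s in [set s : Sigma | dual (val s) (toR (b + hs s))]) cell Q (val s).

End LineBundle.
End Orientations.
End Cones.

(* Main.v *)
Require Import Defs.
From HB Require Import structures.
From mathcomp Require Import all_boot all_order all_algebra.
From mathcomp Require Import finmap generic_quotient.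
From mathcomp Require Import boolp classical_sets functions cardinality reals.

(** The isomorphism already exists on the level of complexes: the degree [b]
    part of the complex of sections is the augmented cellular chain complex of
    [S(h, b)], up to reindexing.

    A section of [L_h] over [U_s] that is homogeneous of degree [b] is a scalar
    multiple of the monomial [b], and a nonzero multiple is allowed exactly when
    [b + h_s] lies in the dual cone of [s] ([sections_supportP]).  Such cones
    [s] are precisely those whose cell lies in [S(h, b)]
    ([cell_sub_support_subcomplex]): if the cell of [s] is covered by cells of
    cones [t] for which [b + h_t] is nonnegative on [t], then [b + h_s] is
    nonnegative on [s], because [h_s] and [h_t] both agree with [h] on the
    intersection of [s] and [t].  A cone of codimension [k] has a cell of
    dimension [n - 1 - k], and coboundary and boundary are given by the same
    incidence numbers.

    To pass to homology, the coefficient of the monomial [b] and the inclusion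
    of the multiples of that monomial are morphisms of complexes in opposite
    directions, by [incidence_map_ffun_map].  Their composites are the identity
    on chains and the identity on homogeneous cochains, so by functoriality
    ([homology_map]) they induce inverse isomorphisms between the reduced
    homology of [S(h, b)] and the classes of homogeneous cocycles. *)

Set Implicit Arguments.
Unset Strict Implicit.
Unset Printing Implicit Defensive.

Import Order.TTheory GRing.Theory Num.Theory.
Local Open Scope classical_set_scope.
Local Open Scope ring_scope.

(** * Functoriality of homology *)

Section HomologyMap.
Variables (A : pzRingType) (V W : lmodType A).
Variables (D : {linear V -> V}) (E : {linear W -> W}) (F : {linear V -> W}).
Variables (C' C : submod V) (B' B : submod W).

Definition is_chain_map := [/\ forall x, F (D x) = E (F x),
  forall x, C' x -> B' (F x) & forall x, C x -> B (F x)].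

Hypothesis Fchain : is_chain_map.

Fact cycle_map_subproof (z : submod_type (cycles D C)) :
  F (submod_val z) \in submod_pred (cycles E B).
Proof.
have [FD _ FC] := Fchain; have /submod_predP[Cz Dz0] := submod_valP z.
apply/submod_predP.
by split; [exact: FC | rewrite -FD Dz0 linear0].
Qed.

Definition cycle_map z : submod_type (cycles E B) :=
  SubmodType (cycle_map_subproof z).

Definition homology_map (q : homology D C' C) : homology E B' B :=
  quot_class _ (cycle_map (repr (q : Quotient.quot _))).

(** A chain map sends boundaries to boundaries, so the representative chosen in
    [homology_map] can be replaced by any other cycle of the class. *)
Lemma homology_map_class z w : submod_val w = F (submod_val z) ->
  homology_map (quot_class _ z) = quot_class _ w.
Proof.
have [FD FC' _] := Fchain; move=> wE; apply/quot_class_eq.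
set r := repr _.
have /quot_class_eq[x C'x rzE] :
    quot_class (boundaries D C' C) r = quot_class _ z.
  by rewrite /quot_class reprK.
exists (F x); first exact: FC'.
rewrite -FD -rzE; change (F (submod_val r) - submod_val w =
  F (submod_val r - submod_val z)).
by rewrite raddfB wE.
Qed.

Fact homology_map_is_linear : linear homology_map.
Proof.
move=> a p q; have [x ->] := quot_class_surj p.
have [y ->] := quot_class_surj q.
rewrite -quot_classZ -quot_classD.
rewrite (@homology_map_class _ (a *: cycle_map x + cycle_map y)).
  rewrite quot_classD quot_classZ.
  by rewrite -!(@homology_map_class _ (cycle_map _) erefl).
by rewrite linearP.
Qed.
HB.instance Definition _ := GRing.isLinear.Build A (homology D C' C)
  (homology E B' B) _ homology_map homology_map_is_linear.

End HomologyMap.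

(** * Change of coefficients in the incidence complex *)

Section FfunMap.
Variables (A : pzRingType) (I : finType) (V W : lmodType A).
Variable u : {linear V -> W}.

Definition ffun_map (f : {ffun I -> V}) : {ffun I -> W} := [ffun i => u (f i)].

Fact ffun_map_is_linear : linear ffun_map.
Proof. by move=> a f g; apply/ffunP => i; rewrite !ffunE linearP. Qed.
HB.instance Definition _ := GRing.isLinear.Build A {ffun I -> V} {ffun I -> W} _
  ffun_map ffun_map_is_linear.

End FfunMap.

(** Incidence numbers act by integer multiples, which every additive map
    respects. Hence a map of coefficients is a chain map between complexes with
    the same cells. *)
Lemma incidence_map_ffun_map (R : realType) (n : nat)
    (Sigma : {fset set 'rV[R]_n})
    (o : forall s : Sigma, 'M[R]_(cone_dim (val s), n))
    (A : pzRingType) (V W : lmodType A) (u : {linear V -> W}) f :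
  ffun_map u (incidence_map o f) = incidence_map o (ffun_map u f).
Proof.
apply/ffunP => t; rewrite !ffunE raddf_sum; apply: eq_bigr => s _.
by rewrite raddfMz ffunE.
Qed.

Section Coefficients.
Variables (A : comPzRingType) (n : nat) (b : 'rV[int]_n).
Local Notation AM := ('rV[int]_n -> A^o).

Definition coefficient (f : AM) : A^o := f b.

Fact coefficient_is_linear : linear coefficient.
Proof. by []. Qed.
HB.instance Definition _ :=
  GRing.isLinear.Build A AM A^o _ coefficient coefficient_is_linear.

Definition monomial_term (a : A^o) : AM := a *: monomial A b.

Fact monomial_term_is_linear : linear monomial_term.
Proof.
by move=> c x y; rewrite /monomial_term scalerDl scalerA.
Qed.
HB.instance Definition _ :=
  GRing.isLinear.Build A A^o AM _ monomial_term monomial_term_is_linear.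

Lemma monomial_termE a m : monomial_term a m = if m == b then a else 0.
Proof.
rewrite -[LHS]/(a * (m == b)%:R).
by case: eqP => _; rewrite ?mulr1 ?mulr0.
Qed.

End Coefficients.

(** * Rescaling of cones and vectors *)

Section Pairing.
Variables (R : realType) (n : nat).

Lemma pairingDl (x y z : 'rV[R]_n) :
  pairing (x + y) z = pairing x z + pairing y z.
Proof.
by rewrite /pairing -big_split; apply: eq_bigr => i _; rewrite mxE mulrDl.
Qed.

Lemma pairingZr (a : R) (x y : 'rV[R]_n) :
  pairing x (a *: y) = a * pairing x y.
Proof.
by rewrite /pairing mulr_sumr; apply: eq_bigr => i _; rewrite mxE mulrCA.
Qed.

Lemma toRD (x y : 'rV[int]_n) : toR R (x + y) = toR R x + toR R y.
Proof. by apply/rowP => i; rewrite !mxE rmorphD. Qed.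

Lemma rational_polyhedralZ (s : set 'rV[R]_n) (a : R) y :
  rational_polyhedral s -> 0 <= a -> s y -> s (a *: y).
Proof.
move=> [k [g ->]] a0 [c [c0 ->]]; exists (fun i => a * c i).
split; first by move=> i; rewrite mulr_ge0.
by rewrite scaler_sumr; apply: eq_bigr => i _; rewrite scalerA.
Qed.

Lemma sphere_rescale (Q : 'M[R]_n) (y : 'rV[R]_n) :
  is_inner_product Q -> y != 0 -> exists2 a, 0 < a & sphere Q (a *: y).
Proof.
move=> [_ Qpos] /Qpos; set q := (_ 0 0) => q0.
exists (Num.sqrt q)^-1; first by rewrite invr_gt0 sqrtr_gt0.
rewrite /sphere /= linearZ /= -!scalemxAl -scalemxAr mxE [X in _ * X]mxE -/q.
by rewrite mulrA -expr2 exprVn sqr_sqrtr ?(ltW q0) // mulVf // gt_eqF.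
Qed.

End Pairing.

(** * Homogeneous sections and cells of the subcomplex *)

Section ToricCohomology.
Variables (R : realType) (n : nat) (A : comPzRingType).
Variable Sigma : {fset set 'rV[R]_n}.
Variable hs : Sigma -> 'rV[int]_n.
Implicit Types (s t : Sigma) (b : 'rV[int]_n).

Lemma finitely_supported_shift (f : 'rV[int]_n -> A^o) c :
  finitely_supported f -> finitely_supported (fun m => f (m + c)).
Proof.
rewrite /finitely_supported => ffin.
have -> : [set m | f (m + c) != 0] = [set m - c | m in [set m | f m != 0]].
  apply/seteqP; split=> m /=.
    by move=> fm; exists (m + c); rewrite ?addrK.
  by move=> [m' fm' <-]; rewrite subrK.
exact: finite_image.
Qed.

(** Multiplication by the monomial [- h_s] translates the support by
    [- h_s]. *)
Lemma sections_supportP s (f : 'rV[int]_n -> A^o) :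
  sections hs s f <->
  finitely_supported f /\
  forall m, f m != 0 -> dual (val s) (toR R (m + hs s)).
Proof.
split=> [[g [gfin gdual] ->]|[ffin fdual]].
  rewrite convolution_monomial opprK; split; last by move=> m /gdual.
  exact: finitely_supported_shift.
exists (fun m => f (m - hs s)); last first.
  by rewrite convolution_monomial; apply/funext => m; rewrite opprK addrK.
by split; [exact: finitely_supported_shift | move=> m /fdual; rewrite subrK].
Qed.

(** The nontrivial direction is local: a point of the cell of [s] lies in some
    cone [t] with [b + h_t] nonnegative on [t], and there [h_s] and [h_t] take
    the same value, namely that of [h].  The points of the unit sphere are
    enough, since the condition on the dual cone is invariant under
    rescaling. *)
Lemma cell_sub_support_subcomplex (Q : 'M[R]_n) (h : 'rV[R]_n -> R) b s :
  (forall t, rational_polyhedral (val t)) -> is_inner_product Q ->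
  (forall t, linear_on (val t) h (hs t)) ->
  cell Q (val s) `<=` support_subcomplex hs b Q <->
  dual (val s) (toR R (b + hs s)).
Proof.
move=> polySigma ipQ hsP; split=> [sub y sy|bs y ys]; last by exists s.
have [->|y0] := eqVneq y 0.
  by rewrite /pairing big1 // => i _; rewrite [X in _ * X]mxE mulr0.
have [a a0 ya] := sphere_rescale ipQ y0.
have sya : val s (a *: y) by apply: rational_polyhedralZ (ltW a0) sy.
have [t bt [tya _]] := sub _ (conj sya ya).
rewrite -(pmulr_rge0 _ a0) -pairingZr toRD pairingDl -(hsP s) //.
by rewrite (hsP t) // -pairingDl -toRD; exact: bt.
Qed.

End ToricCohomology.

(** * The graded pieces of the cohomology *)

Theorem theorem2p7 (R : realType) (n : nat) (A : comPzRingType)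
    (Sigma : {fset set 'rV[R]_n})
    (fanSigma : is_fan Sigma) (completeSigma : is_complete Sigma)
    (Q : 'M[R]_n) (ipQ : is_inner_product Q)
    (o : forall s : Sigma, 'M[R]_(cone_dim (val s), n))
    (oP : is_orientation o)
    (h : 'rV[R]_n -> R) (hP : is_support_function Sigma h)
    (hs : Sigma -> 'rV[int]_n) (hsP : forall s, linear_on (val s) h (hs s))
    (b : 'rV[int]_n) (k : int) :
  exists phi : {linear cohomology_degree o A hs k b ->
      reduced_homology o A Q (support_subcomplex hs b Q) (n%:Z - 1 - k)},
    bijective phi.
Proof.
have polySigma (t : Sigma) : rational_polyhedral (val t).
  by case: fanSigma => /(_ _ (valP t))[].
pose S := support_subcomplex hs b Q.
pose F : {linear {ffun Sigma -> 'rV[int]_n -> A^o} -> {ffun Sigma -> A^o}} :=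
  ffun_map (coefficient (A := A) b).
pose G : {linear {ffun Sigma -> A^o} -> {ffun Sigma -> 'rV[int]_n -> A^o}} :=
  ffun_map (monomial_term (A := A) b).
have FG c : F (G c) = c.
  by apply/ffunP => s; rewrite !ffunE /= /coefficient monomial_termE eqxx.
have GF f : homogeneous b f -> G (F f) = f.
  move=> hf; apply/ffunP => s; rewrite !ffunE /=; apply/funext => m.
  by rewrite monomial_termE; have [->|/hf->] := eqVneq.
have FC (j d : int) f : d = n%:Z - 1 - j ->
    cochains A hs j f -> chains Sigma A Q S d (F f).
  move=> -> Cf s ns; rewrite ffunE /= /coefficient.
  have [/sections_supportP[_ fs] f0] := Cf s.
  apply/eqP; apply: contra_notT ns => fsb; split.
    by apply/(cell_sub_support_subcomplex _ _ polySigma ipQ hsP); exact: fs.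
  have [<-|/eqP/f0 fs0] := eqVneq (n%:Z - (cone_dim (val s))%:Z) j.
    by rewrite opprB [RHS]addrC addrA subrK.
  by rewrite fs0 eqxx in fsb.
have GC (j d : int) c : d = n%:Z - 1 - j ->
    chains Sigma A Q S d c -> cochains A hs j (G c).
  move=> -> Cc s; rewrite ffunE /=; split; last first.
    move=> sj; rewrite Cc ?linear0 // => -[_ sd]; apply: sj.
    rewrite -[(cone_dim _)%:Z](subrK 1) sd addrAC subrK.
    by rewrite opprB addrC subrK.
  apply/sections_supportP; split.
    apply: sub_finite_set (finite_set1 b) => m /=.
    by rewrite monomial_termE; have [|_] := eqVneq m b; rewrite ?eqxx.
  move=> m; rewrite monomial_termE; have [-> csN0|_] := eqVneq m b; last first.
    by rewrite eqxx.
  apply/(cell_sub_support_subcomplex _ _ polySigma ipQ hsP).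
  by apply: contrapT => ns; rewrite Cc ?eqxx // in csN0 => -[].
(* The coboundary raises the codimension while the boundary lowers the
   dimension, so the index preceding [k] corresponds to the index following
   [n - 1 - k]. *)
have degS : n%:Z - 1 - k + 1 = n%:Z - 1 - (k - 1) by rewrite opprB addrA addrAC.
have Fchain : is_chain_map (@incidence_map _ _ _ o _)
    (@incidence_map _ _ _ o _) F
    (cochains A hs (k - 1)) (cochains A hs k)
    (chains Sigma A Q S (n%:Z - 1 - k + 1)) (chains Sigma A Q S (n%:Z - 1 - k)).
  by split=> [f|f|f]; [exact: incidence_map_ffun_map | exact: FC | exact: FC].
have Gchain : is_chain_map (@incidence_map _ _ _ o _)
    (@incidence_map _ _ _ o _) G
    (chains Sigma A Q S (n%:Z - 1 - k + 1)) (chains Sigma A Q S (n%:Z - 1 - k))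
    (cochains A hs (k - 1)) (cochains A hs k).
  by split=> [c|c|c]; [exact: incidence_map_ffun_map | exact: GC | exact: GC].
pose Fh := homology_map Fchain.
pose Gh := homology_map Gchain.
have homogeneous_preimage q :
    {x : cohomology_degree o A hs k b | submod_val x = Gh q}.
  unshelve refine (exist _ (SubmodType _) erefl).
  apply/submod_predP; have [c ->] := quot_class_surj q.
  exists (cycle_map Gchain c); last exact: homology_map_class.
  by move=> s m /negPf mb; rewrite /= ffunE /= monomial_termE mb.
exists (Fh \o val : {linear _ -> _}).
exists (fun q => sval (homogeneous_preimage q)).
- move=> x; apply: val_inj => /=; rewrite (svalP (homogeneous_preimage _)).
  have /submod_predP[z hz ->] := submod_valP x.
  rewrite /Fh (homology_map_class Fchain (w := cycle_map Fchain z) erefl).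
  by apply: homology_map_class; rewrite /= GF.
- move=> q /=; rewrite (svalP (homogeneous_preimage q)).
  have [c ->] := quot_class_surj q.
  rewrite /Gh (homology_map_class Gchain (w := cycle_map Gchain c) erefl).
  by apply: homology_map_class; rewrite /= FG.
Qed.
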